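(* Let $I\subset\mathbb{R}$ be an interval, let $(\boldsymbol{\gamma},\boldsymbol{\nu}_1,\boldsymbol{\nu}_2):I\to\mathbb{R}^3\times\Delta$ be a framed curve with unit tangent vector $\boldsymbol{\mu}=\boldsymbol{\nu}_1\times\boldsymbol{\nu}_2$, let $\{\boldsymbol{v},\boldsymbol{w},\boldsymbol{\mu}\}$ be a rotated frame along $\boldsymbol{\gamma}$, and let $(\overline{\ell},\overline{m},\overline{n},\alpha)$ be the curvature of the framed curve $(\boldsymbol{\gamma},\boldsymbol{v},\boldsymbol{w})$. Fix $\lambda\in\mathbb{R}\setminus\{0\}$ and let $P_{\boldsymbol{\gamma}}[\boldsymbol{v}]:I\to\mathbb{R}^3$, $P_{\boldsymbol{\gamma}}[\boldsymbol{v}](t)=\boldsymbol{\gamma}(t)+\lambda\boldsymbol{v}(t)$. Then there exists a smooth map $\boldsymbol{n}:I\to S^2$ such that $(P_{\boldsymbol{\gamma}}[\boldsymbol{v}],\boldsymbol{v},\boldsymbol{n}):I\to\mathbb{R}^3\times\Delta$ is a framed curve if and only if there exists a smooth function $\varphi:I\to\mathbb{R}$ such that $$\lambda\overline{\ell}(t)\cos\varphi(t)-\{\alpha(t)+\lambda\overline{m}(t)\}\sin\varphi(t)=0$$ for all $t\in I$.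
   Context: All maps are of class $C^\infty$. $S^2$ is the unit sphere in Euclidean space $\mathbb{R}^3$ and $\Delta=\{(\boldsymbol{x},\boldsymbol{y})\in S^2\times S^2\mid \boldsymbol{x}\cdot\boldsymbol{y}=0\}$. Framed curve: a smooth map $(\boldsymbol{\gamma},\boldsymbol{\nu}_1,\boldsymbol{\nu}_2):I\to\mathbb{R}^3\times\Delta$ with $\dot{\boldsymbol{\gamma}}(t)\cdot\boldsymbol{\nu}_1(t)=\dot{\boldsymbol{\gamma}}(t)\cdot\boldsymbol{\nu}_2(t)=0$ for all $t\in I$. Its unit tangent vector is $\boldsymbol{\mu}=\boldsymbol{\nu}_1\times\boldsymbol{\nu}_2$, and its curvature is $(\ell,m,n,\alpha)$ with $\ell=\dot{\boldsymbol{\nu}}_1\cdot\boldsymbol{\nu}_2$, $m=\dot{\boldsymbol{\nu}}_1\cdot\boldsymbol{\mu}$, $n=\dot{\boldsymbol{\nu}}_2\cdot\boldsymbol{\mu}$, $\alpha=\dot{\boldsymbol{\gamma}}\cdot\boldsymbol{\mu}$ (so $\dot{\boldsymbol{\gamma}}=\alpha\boldsymbol{\mu}$). Rotated frame: for a smooth function $\theta:I\to\mathbb{R}$ put $\boldsymbol{v}=\cos\theta\,\boldsymbol{\nu}_1-\sin\theta\,\boldsymbol{\nu}_2$ and $\boldsymbol{w}=\sin\theta\,\boldsymbol{\nu}_1+\cos\theta\,\boldsymbol{\nu}_2$; then $(\boldsymbol{\gamma},\boldsymbol{v},\boldsymbol{w})$ is a framed curve with unit tangent vector $\boldsymbol{v}\times\boldsymbol{w}=\boldsymbol{\mu}$,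 and $\{\boldsymbol{v},\boldsymbol{w},\boldsymbol{\mu}\}$ is called a rotated frame. Its curvature is $(\overline{\ell},\overline{m},\overline{n},\alpha)$ with $\overline{\ell}=\dot{\boldsymbol{v}}\cdot\boldsymbol{w}=\ell-\dot\theta$, $\overline{m}=\dot{\boldsymbol{v}}\cdot\boldsymbol{\mu}=m\cos\theta-n\sin\theta$, $\overline{n}=\dot{\boldsymbol{w}}\cdot\boldsymbol{\mu}=m\sin\theta+n\cos\theta$. *)

(* Defs.v *)
From HB Require Import structures.
From mathcomp Require Import all_boot all_order all_algebra.
From mathcomp Require Import all_classical all_reals all_analysis.

Set Implicit Arguments.
Unset Strict Implicit.
Unset Printing Implicit Defensive.

Import Order.TTheory GRing.Theory Num.Theory.
Import numFieldNormedType.Exports.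

Local Open Scope classical_set_scope.
Local Open Scope ring_scope.

(* A map on an interval I is a total function whose values outside I are
   ignored: its derivative at t in I is the limit of the difference quotients
   at points s of I, hence a one-sided derivative at an end point of I that
   belongs to I. The values of [derive_in I f] outside I are irrelevant. *)
Section Smooth.
Context {R : realType} {V : normedModType R}.
Implicit Types (I : set R) (f : R -> V) (t : R).

Definition diff_quot f t (s : R) : V := (s - t)^-1 *: (f s - f t).

Definition derivable_in I f t : Prop :=
  cvg (diff_quot f t s @[s --> within I t^']).

Definition derive_in I f t : V :=
  lim (diff_quot f t s @[s --> within I t^']).

Definition smooth_on I f : Prop :=
  forall (k : nat) t, I t -> derivable_in I (iter k (derive_in I) f) t.

End Smooth.

Section FramedCurves.
Context {R : realType}.
Implicit Types (I : set R) (t : R).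

Definition dot (x y : 'rV[R]_3) : R := \sum_(i < 3) x 0 i * y 0 i.

(* The indices k + 1 and k + 2 are taken modulo 3, in the ring 'I_3. *)
Definition cross (x y : 'rV[R]_3) : 'rV[R]_3 :=
  \row_(k < 3) (x 0 (k + 1) * y 0 (k + 2) - x 0 (k + 2) * y 0 (k + 1)).

Definition S2 : set 'rV[R]_3 := [set x | dot x x = 1].

Definition Delta : set ('rV[R]_3 * 'rV[R]_3) :=
  [set p | [/\ S2 p.1, S2 p.2 & dot p.1 p.2 = 0]].

Definition framed_curve I (gamma nu1 nu2 : R -> 'rV[R]_3) : Prop :=
  [/\ smooth_on I gamma, smooth_on I nu1, smooth_on I nu2,
      forall t, I t -> Delta (nu1 t, nu2 t) &
      forall t, I t -> dot (derive_in I gamma t) (nu1 t) = 0 /\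
                       dot (derive_in I gamma t) (nu2 t) = 0].

Definition unit_tangent (nu1 nu2 : R -> 'rV[R]_3) t : 'rV[R]_3 := cross (nu1 t) (nu2 t).

Definition curv_l I (nu1 nu2 : R -> 'rV[R]_3) t : R := dot (derive_in I nu1 t) (nu2 t).

Definition curv_m I (nu1 nu2 : R -> 'rV[R]_3) t : R :=
  dot (derive_in I nu1 t) (unit_tangent nu1 nu2 t).

Definition curv_n I (nu1 nu2 : R -> 'rV[R]_3) t : R :=
  dot (derive_in I nu2 t) (unit_tangent nu1 nu2 t).

Definition curv_alpha I (gamma nu1 nu2 : R -> 'rV[R]_3) t : R :=
  dot (derive_in I gamma t) (unit_tangent nu1 nu2 t).

(* The third vector of the rotated frame is [unit_tangent nu1 nu2]. *)
Definition rotated_frame I (nu1 nu2 v w : R -> 'rV[R]_3) : Prop :=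
  exists theta : R -> R, smooth_on I theta /\
    forall t, I t ->
      v t = cos (theta t) *: nu1 t - sin (theta t) *: nu2 t /\
      w t = sin (theta t) *: nu1 t + cos (theta t) *: nu2 t.

End FramedCurves.

(* Main.v *)
Require Import Defs.
From HB Require Import structures.
From mathcomp Require Import all_boot all_order all_algebra.
From mathcomp Require Import all_classical all_reals all_analysis.
From mathcomp Require Import ring lra.
Import Order.TTheory GRing.Theory Num.Theory.
Import numFieldNormedType.Exports.

Local Open Scope classical_set_scope.
Local Open Scope ring_scope.

Set Implicit Arguments.
Unset Strict Implicit.
Unset Printing Implicit Defensive.

(** A rotated frame [v, w] is again a framing of [gamma]
    ([framed_curve_rotate]), so only [v], [w] and [mu = v x w] matter. Put
    [P = gamma + lambda v]. Since [gamma'] is orthogonal to [v] and [w], and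
    [v'] is orthogonal to the unit vector [v], the derivative [P'] has
    coordinates [0], [lambda l], [alpha + lambda m] in the orthonormal frame
    [v, w, mu]. A unit vector [n] orthogonal to [v] is
    [cos phi w - sin phi mu] for some angle [phi], and then the scalar product
    of [P'] and [n] is exactly the left-hand side of the equation on [phi].

    Given a smooth [phi], this formula defines a smooth [n]. Conversely, given
    [n], the functions [c = n . w] and [s = - n . mu] are smooth and satisfy
    [c^2 + s^2 = 1]; it remains to write them as [cos phi] and [sin phi] with
    one smooth [phi] on all of [I] ([angle_lift]). Such a [phi] must satisfy
    [phi' = c s' - s c'], so it is taken to be a primitive of the right-hand
    side with the correct value at one point. The function
    [c cos phi + s sin phi] then has zero derivative and equals [1] at that
    point, hence everywhere, which forces [c = cos phi] and [s = sin phi].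

    As derivatives are taken within [I] (one-sided at an end point), the calculus
    used is first established in that setting: the Leibniz rule for continuous
    bilinear maps, which covers the scalar, dot and cross products
    ([has_deriv_bilinear]), the chain rule ([has_deriv_comp]), constancy
    under a zero derivative ([const_of_deriv0]) and the existence of primitives
    ([primitive_exists]). *)

(** * Derivatives within a set *)

Section Derivative.
Context {R : realType} {V : normedModType R}.
Implicit Types (I : set R) (f g : R -> V) (t : R) (d : V).

(** The relational form of [derive_in]: it needs no separate convergence
    hypothesis, and rules for it can be proved without uniqueness of limits. *)
Definition has_deriv I f t d : Prop :=
  diff_quot f t s @[s --> within I t^'] --> d.

Lemma near_in_dnbhs I t : \forall s \near within I t^', I s /\ s != t.
Proof.
rewrite near_withinE; have := nbhs_dnbhs_neq t.
by apply: filterS => s.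
Qed.

Lemma has_deriv_eq I f g t d : {in I, f =1 g} -> I t ->
  has_deriv I f t d -> has_deriv I g t d.
Proof.
move=> fg It; apply: cvg_trans; apply: near_eq_cvg.
near=> s; rewrite /diff_quot !fg ?inE//.
by have [] : I s /\ s != t by near: s; exact: near_in_dnbhs.
Unshelve. all: by end_near. Qed.

Lemma has_deriv_cvg I f t d : has_deriv I f t d ->
  f s @[s --> within I t^'] --> f t.
Proof.
move=> fd.
have : (s - t) *: diff_quot f t s + f t @[s --> within I t^'] --> (t - t) *: d + f t.
  apply: cvgD; last exact: cvg_cst.
  apply: cvgZ => //; apply: cvgB; last exact: cvg_cst.
  exact: cvg_trans (cvg_within (F := t^') I) (cvg_within (F := nbhs t) _).
rewrite subrr scale0r add0r; apply: cvg_trans; apply: near_eq_cvg.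
near=> s.
have [_ st] : I s /\ s != t by near: s; exact: near_in_dnbhs.
by rewrite /diff_quot scalerA divff ?subr_eq0// scale1r subrK.
Unshelve. all: by end_near. Qed.

Lemma has_deriv_cst I (c : V) t : has_deriv I (fun=> c) t 0.
Proof.
apply: cvg_trans (cvg_cst (F := within I t^') (0 : V)); apply: near_eq_cvg; near=> s.
by rewrite /diff_quot subrr scaler0.
Unshelve. all: by end_near. Qed.

Lemma has_derivD I f g t d e : has_deriv I f t d -> has_deriv I g t e ->
  has_deriv I (fun s => f s + g s) t (d + e).
Proof.
move=> fd gd; apply: cvg_trans (cvgD (F := within I t^') fd gd).
apply: near_eq_cvg; near=> s.
by rewrite /diff_quot opprD addrACA scalerDr.
Unshelve. all: by end_near. Qed.

(** The point [t] is not isolated in [I], so that limits of difference quotients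
    are unique. *)
Lemma limit_point_itv I t : is_interval I -> (exists a b, [/\ I a, I b & a < b]) ->
  I t -> ProperFilter (within I t^').
Proof.
move=> II [a [b [Ia Ib ab]]] It; apply: Build_ProperFilter_ex.
move=> P; rewrite /within/= /dnbhs/within/= => -[e /= e0 eP].
have [at0|ta] := ltP a t.
(* A point of I on the side of t where I is known to extend, clipped to I. *)
- exists (Num.max a (t - e / 2)); apply: eP.
  + rewrite /ball/= ltr_distlC gt_max lt_max; lra.
  + by rewrite lt_eqF// gt_max at0; lra.
  + by apply: (II a t) => //; rewrite le_max lexx/= ge_max (ltW at0); lra.
- exists (Num.min b (t + e / 2)); apply: eP.
  + rewrite /ball/= ltr_distlC gt_min lt_min; lra.
  + by rewrite gt_eqF// lt_min; lra.
  + by apply: (II t b) => //; rewrite ge_min lexx/= le_min; lra.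
Qed.
End Derivative.

Section Leibniz.
Context {R : realType} {U V W : normedModType R} (B : {bilinear U -> V -> W}).

Hypothesis Bcont : continuous (fun p : U * V => B p.1 p.2).

(** The usual Leibniz splitting
    [B x y - B x0 y0 = B (x - x0) y + B x0 (y - y0)], where [y] tends to [y0] because
    a function with a derivative is continuous. *)
Lemma has_deriv_bilinear I (f : R -> U) (g : R -> V) t d e :
  has_deriv I f t d -> has_deriv I g t e ->
  has_deriv I (fun s => B (f s) (g s)) t (B d (g t) + B (f t) e).
Proof.
move=> fd ge.
have Bcvg (T : Type) (F : set_system T) (FF : Filter F) (p : T -> U) (q : T -> V) a b :
    p x @[x --> F] --> a -> q x @[x --> F] --> b -> B (p x) (q x) @[x --> F] --> B a b.
  by move=> pa qb; apply: (continuous2_cvg (h := B) FF _ pa qb); exact: (@Bcont (a, b)).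
apply: cvg_trans; last first.
  exact: cvgD (Bcvg _ _ _ _ _ _ _ fd (has_deriv_cvg ge))
              (Bcvg _ _ _ _ _ _ _ (cvg_cst (f t)) ge).
apply: near_eq_cvg; near=> s.
rewrite fctE /diff_quot linearZl_LR linearZr_LR/= linearBl linearBr/=.
by rewrite -scalerDr addrA subrK.
Unshelve. all: by end_near. Qed.
End Leibniz.

Section ChainRule.
Context {R : realType}.

(** Carathéodory's form of the chain rule: [h y - h (f t)] is
    [q y * (y - f t)] with [q] continuous at [f t], which avoids dividing by
    increments of [f] that may vanish. *)
Lemma has_deriv_comp (h dh : R -> R) I (f : R -> R) t d :
  is_derive (f t) 1 h (dh (f t)) ->
  has_deriv I f t d -> has_deriv I (h \o f) t (dh (f t) * d).
Proof.
move=> [hd hE] fd.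
pose q y := if y == f t then dh (f t) else (h y - h (f t)) / (y - f t).
have hq y : h y - h (f t) = q y * (y - f t).
  rewrite /q; case: eqVneq => [->|yt]; first by rewrite !subrr mulr0.
  by rewrite divfK// subr_eq0.
have qc : q y @[y --> f t] --> q (f t).
  have hD : h' ^-1 *: ((h \o shift (f t)) (h' *: 1) - h (f t)) @[h' --> 0^']
      --> dh (f t).
    by rewrite -hE; exact: hd.
  have sh : y - f t @[y --> f t] --> (0 : R).
    rewrite -(subrr (f t)).
    by apply: (cvgB (F := nbhs (f t))); [exact: cvg_id|exact: cvg_cst].
  rewrite {2}/q eqxx => P nP.
  have hP : \forall k \near (0 : R),
    k != 0 -> P (k^-1 * (h (k * 1 + f t) - h (f t))) by exact: hD nP.
  have hyP : \forall y \near f t, y - f t != 0 ->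
    P ((y - f t)^-1 * (h ((y - f t) * 1 + f t) - h (f t))) by exact: sh hP.
  suff : \forall y \near f t, P (q y) by [].
  apply: filterS hyP => y; rewrite /q subr_eq0.
  case: eqVneq => [_ _|yt /(_ isT)]; first exact: nbhs_singleton.
  by rewrite mulr1 subrK mulrC.
have qf : q (f s) @[s --> within I t^'] --> q (f t).
  exact: cvg_comp (has_deriv_cvg fd) qc.
rewrite /has_deriv; apply: cvg_trans; last first.
  have -> : dh (f t) = q (f t) by rewrite /q eqxx.
  exact: cvgM qf fd.
apply: near_eq_cvg.
near=> s; rewrite /diff_quot/= hq.
by rewrite /GRing.scale/= mulrCA.
Unshelve. all: by end_near. Qed.
End ChainRule.

(** * Functions of class C^n on a set *)

Section Smooth.
Context {R : realType}.
Implicit Types (I : set R).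

(** Class C^n on [I], with a derivative that is asserted to exist instead of
    computed as a limit: stability under the operations below is then a plain
    induction on [n]. *)
Fixpoint Cn {V : normedModType R} I (n : nat) (f : R -> V) : Prop :=
  if n is m.+1 then
    exists g, (forall t, I t -> has_deriv I f t (g t)) /\ Cn I m g
  else True.

Lemma Cn_eq (V : normedModType R) I n (f g : R -> V) :
  {in I, f =1 g} -> Cn I n f -> Cn I n g.
Proof.
case: n => //= n fg [df [fdf dfn]]; exists df; split=> // t It.
exact: has_deriv_eq fg It (fdf t It).
Qed.

Lemma CnW (V : normedModType R) I n (f : R -> V) : Cn I n.+1 f -> Cn I n f.
Proof.
elim: n f => //= n IH f [df [fdf dfn]]; exists df; split=> //.
exact: IH.
Qed.

Lemma Cn_cst (V : normedModType R) I n (c : V) : Cn I n (fun=> c).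
Proof.
elim: n c => //= n IH c; exists (fun=> 0); split=> // t _.
exact: has_deriv_cst.
Qed.

Lemma CnD (V : normedModType R) I n (f g : R -> V) :
  Cn I n f -> Cn I n g -> Cn I n (fun t => f t + g t).
Proof.
elim: n f g => //= n IH f g [df [fdf dfn]] [dg [gdg dgn]].
exists (fun t => df t + dg t); split; last exact: IH.
by move=> t It; apply: has_derivD; [exact: fdf|exact: gdg].
Qed.

Lemma Cn_bilinear (U V W : normedModType R) (B : {bilinear U -> V -> W})
    I n (f : R -> U) (g : R -> V) :
  continuous (fun p : U * V => B p.1 p.2) ->
  Cn I n f -> Cn I n g -> Cn I n (fun t => B (f t) (g t)).
Proof.
move=> Bc; elim: n f g => //= n IH f g fn gn.
have [df [fdf dfn]] := fn; have [dg [gdg dgn]] := gn.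
exists (fun t => B (df t) (g t) + B (f t) (dg t)); split.
  by move=> t It; apply: has_deriv_bilinear => //; [exact: fdf|exact: gdg].
apply: CnD; apply: IH => //; exact: CnW.
Qed.

End Smooth.

(** * Smooth functions on a nondegenerate interval *)

Section SmoothOn.
Context {R : realType} (I : set R).
Hypothesis I_itv : is_interval I.
Hypothesis I_nondeg : exists a b, [/\ I a, I b & a < b].

Lemma derive_inE (V : normedModType R) (f : R -> V) t d :
  I t -> has_deriv I f t d -> derive_in I f t = d.
Proof.
move=> It fd; have := limit_point_itv I_itv I_nondeg It => ?.
by apply: cvg_lim => //; exact: norm_hausdorff.
Qed.

(** Links the iterated limits of [smooth_on] to the inductive [Cn]. The direction
    from [Cn] uses that a derivative within [I] is unique at the points of [I]. *)
Lemma smooth_onP (V : normedModType R) (f : R -> V) :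
  smooth_on I f <-> forall n, Cn I n f.
Proof.
split=> [sf n|Cf k].
  elim: n f sf => //= n IH f sf; exists (derive_in I f); split.
    by move=> t It; exact: (sf 0%N t It).
  by apply: IH => k t It; rewrite -iterSr; exact: sf.
elim: k f Cf => [|k IH] f Cf t It.
  by have [df [/(_ t It) fdf _]] := Cf 1%N; apply: cvgP fdf.
rewrite iterSr; apply: IH => // n.
have [df [fdf dfn]] := Cf n.+1.
apply: Cn_eq dfn => u; rewrite inE => Iu.
by rewrite (derive_inE Iu (fdf u Iu)).
Qed.

Lemma smooth_on_deriv (V : normedModType R) (f : R -> V) t :
  smooth_on I f -> I t -> has_deriv I f t (derive_in I f t).
Proof. by move=> sf It; exact: (sf 0%N t It). Qed.

Lemma smooth_on_derive (V : normedModType R) (f : R -> V) :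
  smooth_on I f -> smooth_on I (derive_in I f).
Proof. by move=> sf k t It; rewrite -iterSr; exact: sf. Qed.

Lemma sub_itv a b : I a -> I b -> `[a, b] `<=` I.
Proof.
by move=> Ia Ib x /=; rewrite in_itv/= => ?; exact: (I_itv Ia Ib).
Qed.

(** [has_deriv_cvg] gives limits along punctured neighbourhoods, while the mean
    value theorem and integrability ask for subspace continuity. *)
Lemma within_continuous_of_punctured (A : set R) (f : R -> R) : A `<=` I ->
  (forall x, I x -> f s @[s --> within I x^'] --> f x) ->
  {within A, continuous f}.
Proof.
move=> AI fc; apply/subspace_continuousP => x Ax.
apply/cvgrPdist_le => e e0.
have /cvgrPdist_le/(_ e e0) nf := fc x (AI x Ax).
have nf' : \forall s \near x, s != x -> I s -> `|f x - f s| <= e by exact: nf.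
suff : \forall s \near x, A s -> `|f x - f s| <= e by [].
apply: filterS nf' => s fs As; have [->|sx] := eqVneq s x.
  by rewrite subrr normr0 ltW.
by apply: fs => //; exact: AI.
Qed.

(** By the mean value theorem: at the interior points of the segment the derivative
    within [I] is the ordinary one, and continuity suffices at its end points. *)
Lemma const_of_deriv0 (f : R -> R) :
  (forall t, I t -> has_deriv I f t 0) -> forall a b, I a -> I b -> f a = f b.
Proof.
move=> f0 a b; wlog ab : a b / a <= b.
  by move=> H Ia Ib; case: (leP a b) => [|/ltW] ?; [|symmetry]; exact: H.
move=> Ia Ib; apply/esym/eqP; rewrite -subr_eq0; apply/eqP.
suff [c _ ->] : exists2 c, c \in `[a, b] & f b - f a = (fun=> 0) c * (b - a).
  by rewrite mul0r.
apply: MVT_segment => // [x|].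
  rewrite in_itv/= => /andP[ax xb].
  have Ix : I x by apply: (I_itv Ia Ib); rewrite !ltW.
  have fx : h^-1 *: ((f \o shift x) (h *: 1) - f x) @[h --> 0^'] --> 0.
    have sh : (h + x) @[h --> 0^'] --> within I x^'.
      move=> P; rewrite /within/= /dnbhs/within/= => nP.
      have hx : h + x @[h --> 0] --> 0 + x.
        by apply: (cvgD (F := nbhs 0)); [exact: cvg_id|exact: cvg_cst].
      rewrite add0r in hx.
      have nI : \forall s \near x, I s.
        have xab : x \in `]a, b[ by rewrite in_itv/= ax.
        apply: filterS (near_in_itvoo xab) => s; rewrite in_itv/= => /andP[sa sb].
        by apply: (I_itv Ia Ib); rewrite !ltW.
      have nPI : \forall s \near x, s != x -> P s.
        have nP' : \forall s \near x, s != x -> I s -> P s by exact: nP.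
        by apply: filterS2 nI nP' => s Is sP sx; exact: sP.
      have nPh : \forall h \near (0 : R), h + x != x -> P (h + x) by exact: hx nPI.
      suff : \forall h \near (0 : R), h != 0 -> P (h + x) by [].
      by apply: filterS nPh => h hP h0; apply: hP; rewrite -subr_eq0 addrK.
    have := cvg_comp _ _ sh (f0 x Ix); apply: cvg_trans; apply: near_eq_cvg.
    near=> h; rewrite /diff_quot/= addrK.
    by have -> : (h%:A : R) = h by exact: mulr1.
  by split; [exact: cvgP fx|exact: cvg_lim fx].
apply: within_continuous_of_punctured (sub_itv Ia Ib) _ => x Ix.
exact: has_deriv_cvg (f0 x Ix).
Unshelve. all: by end_near. Qed.

End SmoothOn.

(** * Primitives and angle lifting *)

Section Primitive.
Context {R : realType} (I : set R).
Hypothesis I_itv : is_interval I.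
Notation mu := (@lebesgue_measure R).
Variable g : R -> R.
Hypothesis g_cont : forall x, I x -> g s @[s --> within I x^'] --> g x.

Let ig a b : I a -> I b -> mu.-integrable `[a, b] (EFin \o g).
Proof.
move=> Ia Ib; apply: continuous_compact_integrable; first exact: segment_compact.
exact: within_continuous_of_punctured (sub_itv I_itv Ia Ib) g_cont.
Qed.

Let int0 a b : b <= a -> \int[mu]_(x in `[a, b]) g x = 0.
Proof.
rewrite le_eqVlt => /predU1P[->|ba]; first by rewrite set_itv1 Rintegral_set1.
by rewrite set_itv_ge ?Rintegral_set0// bnd_simp -ltNge.
Qed.

Let chasles a x b : I a -> I b -> a <= x -> x <= b ->
  \int[mu]_(y in `[a, b]) g y =
  \int[mu]_(y in `[a, x]) g y + \int[mu]_(y in `[x, b]) g y.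
Proof.
move=> Ia Ib ax xb; have Ix : I x by apply: (I_itv Ia Ib); rewrite ax.
apply/eqP; rewrite addrC -subr_eq; apply/eqP.
rewrite Rintegral_itvB ?bnd_simp//; last exact: ig.
rewrite Rintegral_itv_obnd_cbnd//; apply: integrableS (ig Ix Ib) => //.
by apply: subset_itvr; rewrite bnd_simp.
Qed.

Let bound (a b c e : R) : I a -> I b -> a <= b ->
  (forall x, a <= x <= b -> `|c - g x| <= e) ->
  `|(b - a) * c - \int[mu]_(x in `[a, b]) g x| <= e * (b - a).
Proof.
move=> Ia Ib ab ge.
have mab : fine (mu `[a, b]) = b - a.
  rewrite lebesgue_measure_itv/= lte_fin.
  by move: ab; rewrite le_eqVlt => /predU1P[->|->//]; rewrite ltxx subrr.
have ic k : mu.-integrable `[a, b] (EFin \o cst k).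
  apply: continuous_compact_integrable; first exact: segment_compact.
  by apply: continuous_subspaceT => x; exact: cvg_cst.
have := Rintegral_cst mu (measurable_itv `[a, b]) c; rewrite mab mulrC => <-.
rewrite -RintegralB//; last 2 first.
  exact: ic.
  exact: ig.
rewrite -mab -Rintegral_cst//.
have icg : mu.-integrable `[a, b] (EFin \o (fun x => c - g x)).
  have -> : EFin \o (fun x => c - g x) = ((EFin \o cst c) \- (EFin \o g))%E by [].
  by apply: integrableB => //; exact: ig.
apply: le_trans (le_normr_Rintegral _ icg) _ => //.
apply: le_Rintegral => //; [exact: integrable_norm icg|exact: ic].
Qed.

(** The increments of the signed integral of [g] from a base point are integrals
    over the segments between the two points, so the difference quotients at [t]
    are means of [g] near [t]. This works alike for the three kinds of points of [I]
    (interior, left end, right end). *)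
Lemma primitive_exists : I !=set0 ->
  exists G : R -> R, forall t, I t -> has_deriv I G t (g t).
Proof.
move=> [t0 It0].
(* One of the two integrals vanishes, which encodes the sign of t - t0. *)
pose G t := \int[mu]_(x in `[t0, t]) g x - \int[mu]_(x in `[t, t0]) g x.
have GB a b : I a -> I b -> a <= b -> G b - G a = \int[mu]_(x in `[a, b]) g x.
  move=> Ia Ib ab; rewrite /G.
  have [t0a|/ltW at0] := leP t0 a.
    rewrite (int0 t0a) (int0 (le_trans t0a ab)) (chasles It0 Ib t0a ab).
    by rewrite !subr0 [X in X - _]addrC addrK.
  have [t0b|/ltW bt0] := leP t0 b.
    rewrite (int0 at0) (int0 t0b) (chasles Ia Ib at0 t0b).
    by rewrite subr0 sub0r opprK addrC.
  rewrite (int0 at0) (int0 bt0) (chasles Ia It0 ab bt0).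
  by rewrite !sub0r opprK addrC addrK.
exists G => t It; apply/cvgrPdist_le => e e0.
have /cvgrPdist_le/(_ e e0) gt := g_cont It.
have {gt} gt : \forall s \near t, s != t -> I s -> `|g t - g s| <= e by exact: gt.
suff : \forall s \near t, s != t -> I s -> `|g t - diff_quot G t s| <= e by [].
move: gt => /nbhs_ballP[d /= d0 gd]; apply/nbhs_ballP; exists d => //= s std st Is.
have {}gd x : I x -> ball t d x -> `|g t - g x| <= e.
  move=> Ix tx; have [->|xt] := eqVneq x t; first by rewrite subrr normr0 ltW.
  exact: gd.
move: std; rewrite /ball/= => std.
suff : `|(s - t) * g t - (G s - G t)| <= e * `|s - t|.
  have s0 : s - t != 0 by rewrite subr_eq0.
  rewrite -ler_pdivrMr ?normr_gt0// -normf_div; congr (`|_| <= _).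
  by rewrite /diff_quot/= /GRing.scale/=; field.
have [ts|/ltW ts] := leP t s.
  rewrite GB// (ger0_norm (x := s - t)) ?subr_ge0//.
  apply: bound => // x /andP[tx xs]; apply: gd.
    by apply: (I_itv It Is); rewrite tx.
  by move: std; rewrite /ball/= !ltr_distlC; lra.
have -> : (s - t) * g t - (G s - G t) = - ((t - s) * g t - (G t - G s)) by ring.
rewrite GB// normrN (distrC s t) (ger0_norm (x := t - s)) ?subr_ge0//.
apply: bound => // x /andP[sx xt]; apply: gd.
  by apply: (I_itv Is It); rewrite sx.
by move: std; rewrite /ball/= !ltr_distlC; lra.
Qed.

End Primitive.

Section Scale.
Context {R : realType}.

(** The scalar factor lives in [R^o], the module over [R] whose elements are the
    scalars, so that scaling is bilinear over [R]. *)
Lemma scale_is_bilinear (V : lmodType R) : bilinear_for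
  (GRing.Scale.Law.clone _ _ *:%R _) (GRing.Scale.Law.clone _ _ *:%R _)
  (@GRing.scale R V : R^o -> V -> V).
Proof.
split=> [u'|u] a x y /=; first by rewrite scalerDl scalerA.
by rewrite scalerDr !scalerA mulrC.
Qed.
HB.instance Definition _ (V : lmodType R) :=
  bilinear_isBilinear.Build R R^o V V _ _ (@GRing.scale R V : R^o -> V -> V)
  (scale_is_bilinear V).

End Scale.

Section Trig.
Context {R : realType}.

(** Both functions are treated together because each one occurs in the derivative
    of the other. *)
Lemma Cn_cos_sin (I : set R) n (f : R -> R) : Cn I n f ->
  Cn I n (fun t => cos (f t)) /\ Cn I n (fun t => sin (f t)).
Proof.
elim: n f => //= n IH f [df [fdf dfn]]; have fn : Cn I n.+1 f by exists df.
have [cn sn] := IH f (CnW fn).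
have Cn_mul (p q : R -> R) : Cn I n p -> Cn I n q -> Cn I n (fun t => p t * q t).
  by apply: Cn_bilinear => x; exact: mul_continuous.
split.
  exists (fun t => - sin (f t) * df t); split.
    move=> t It; apply: (@has_deriv_comp _ cos (fun x => - sin x)); exact: fdf.
  apply: (Cn_mul _ _ _ dfn); apply: (@Cn_eq _ _ _ _ (fun t => -1 * sin (f t))).
    by move=> t _; rewrite mulN1r.
  by apply: Cn_mul => //; exact: Cn_cst.
exists (fun t => cos (f t) * df t); split; last exact: Cn_mul.
move=> t It; apply: (@has_deriv_comp _ sin cos); exact: fdf.
Qed.

Lemma angle_exists (c s : R) : c ^+ 2 + s ^+ 2 = 1 ->
  exists phi, cos phi = c /\ sin phi = s.
Proof.
move=> cs1; have c1 : -1 <= c <= 1.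
  by rewrite -ler_norml -(@expr_le1 _ 2)// real_normK ?num_real//; nra.
have cE : cos (acos c) = c by apply: acosK; rewrite in_itv.
have sE : sin (acos c) = `|s|.
  by rewrite sin_acos// -cs1 [X in X - _]addrC addrK sqrtr_sqr.
case: (leP 0 s) => s0; [exists (acos c)|exists (- acos c)].
  by rewrite sE ger0_norm.
by rewrite cosN sinN sE ltr0_norm// opprK.
Qed.

End Trig.

Section Lift.
Context {R : realType} (I : set R).
Hypothesis I_itv : is_interval I.
Hypothesis I_nondeg : exists a b, [/\ I a, I b & a < b].

Let CnP (V : normedModType R) (f : R -> V) :=
  smooth_onP I_itv I_nondeg f.

Lemma smooth_onD (V : normedModType R) (f g : R -> V) :
  smooth_on I f -> smooth_on I g -> smooth_on I (fun t => f t + g t).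
Proof. by move=> /CnP sf /CnP sg; apply/CnP => n; exact: CnD. Qed.

Lemma smooth_on_eq (V : normedModType R) (f g : R -> V) :
  {in I, f =1 g} -> smooth_on I f -> smooth_on I g.
Proof. by move=> fg /CnP sf; apply/CnP => n; apply: Cn_eq fg _; exact: sf. Qed.

Lemma smooth_on_cst (V : normedModType R) (c : V) : smooth_on I (fun=> c).
Proof. by apply/CnP => n; exact: Cn_cst. Qed.

Lemma smooth_on_bilinear (U V W : normedModType R) (B : {bilinear U -> V -> W})
    (f : R -> U) (g : R -> V) :
  continuous (fun p : U * V => B p.1 p.2) ->
  smooth_on I f -> smooth_on I g -> smooth_on I (fun t => B (f t) (g t)).
Proof.
move=> Bc /CnP sf /CnP sg; apply/CnP => n.
exact: Cn_bilinear.
Qed.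

Lemma smooth_onM (f g : R -> R) :
  smooth_on I f -> smooth_on I g -> smooth_on I (fun t => f t * g t).
Proof. by apply: smooth_on_bilinear => x; exact: mul_continuous. Qed.

Lemma smooth_onZ (V : normedModType R) (a : R -> R) (f : R -> V) :
  smooth_on I a -> smooth_on I f -> smooth_on I (fun t => a t *: f t).
Proof.
move=> sa sf.
apply: (smooth_on_bilinear _ sa sf (B := @GRing.scale R V : R^o -> V -> V)).
exact: scale_continuous.
Qed.

Lemma smooth_onB (V : normedModType R) (f g : R -> V) :
  smooth_on I f -> smooth_on I g -> smooth_on I (fun t => f t - g t).
Proof.
move=> sf sg.
apply: (smooth_on_eq (f := fun t => f t + -1 *: g t)).
  by move=> t _; rewrite scaleN1r.
apply: smooth_onD sf _; apply: (smooth_onZ (a := fun=> -1) _ sg).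
exact: smooth_on_cst.
Qed.

Lemma smooth_on_cos (f : R -> R) : smooth_on I f -> smooth_on I (fun t => cos (f t)).
Proof. by move=> /CnP sf; apply/CnP => n; have [] := Cn_cos_sin (sf n). Qed.

Lemma smooth_on_sin (f : R -> R) : smooth_on I f -> smooth_on I (fun t => sin (f t)).
Proof. by move=> /CnP sf; apply/CnP => n; have [] := Cn_cos_sin (sf n). Qed.

Lemma smooth_on_of_deriv (f g : R -> R) :
  (forall t, I t -> has_deriv I f t (g t)) -> smooth_on I g -> smooth_on I f.
Proof.
move=> fg /CnP sg; apply/CnP => -[//|n]; by exists g; split.
Qed.

Lemma has_derivM (f g : R -> R) t d e : has_deriv I f t d -> has_deriv I g t e ->
  has_deriv I (fun s => f s * g s) t (d * g t + f t * e).
Proof. by apply: has_deriv_bilinear => x; exact: mul_continuous. Qed.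

Lemma has_deriv_uniq (V : normedModType R) (f : R -> V) t d e : I t ->
  has_deriv I f t d -> has_deriv I f t e -> d = e.
Proof.
by move=> It fd fe; rewrite -(derive_inE I_itv I_nondeg It fd); exact: derive_inE fe.
Qed.

(** The angular velocity of the point [(c, s)] of the unit circle is [c s' - s c'].
    Integrating it avoids gluing local inverses of cosine and sine, and makes the
    angle smooth because its derivative is. *)
Lemma angle_lift (c s : R -> R) : smooth_on I c -> smooth_on I s ->
  (forall t, I t -> c t ^+ 2 + s t ^+ 2 = 1) ->
  exists phi, smooth_on I phi /\
    forall t, I t -> cos (phi t) = c t /\ sin (phi t) = s t.
Proof.
move=> sc ss cs1; have [t0 [_ [It0 _ _]]] := I_nondeg.
pose dc := derive_in I c; pose ds := derive_in I s.
pose w t := c t * ds t - s t * dc t.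
have sdc : smooth_on I dc by exact: smooth_on_derive.
have sds : smooth_on I ds by exact: smooth_on_derive.
have sw : smooth_on I w.
  exact: smooth_onB (smooth_onM sc sds) (smooth_onM ss sdc).
have [G0 G0w] : exists G : R -> R, forall t, I t -> has_deriv I G t (w t).
  apply: primitive_exists => //; last by exists t0.
  by move=> x Ix; apply: has_deriv_cvg (smooth_on_deriv sw Ix).
have [p0 [cp0 sp0]] := angle_exists (cs1 t0 It0).
pose phi t := G0 t + (p0 - G0 t0).
have phiw t : I t -> has_deriv I phi t (w t).
  move=> It; rewrite -[w t]addr0; apply: has_derivD; first exact: G0w.
  exact: has_deriv_cst.
exists phi; split; first exact: smooth_on_of_deriv sw.
(* The curve (c, s) stays on the circle, so its velocity is tangent. *)
have ort t : I t -> c t * dc t + s t * ds t = 0.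
  move=> It.
  have h1 := has_derivD (has_derivM (smooth_on_deriv sc It) (smooth_on_deriv sc It))
                    (has_derivM (smooth_on_deriv ss It) (smooth_on_deriv ss It)).
  have h2 : has_deriv I (fun t => c t * c t + s t * s t) t 0.
    apply: (has_deriv_eq _ It (has_deriv_cst I (1 : R) t)) => u; rewrite inE => Iu.
    by rewrite -!expr2 cs1.
  by have := has_deriv_uniq It h1 h2; rewrite -/dc -/ds; lra.
(* The angular velocity w gives c' = - s w and s' = c w, the equations that
   cos phi and sin phi satisfy as well. *)
have key t : I t -> has_deriv I (fun u => c u * cos (phi u) + s u * sin (phi u)) t 0.
  move=> It.
  have hc := @has_deriv_comp _ cos (fun x => - sin x) _ _ _ _
    (is_derive_cos _) (phiw t It).
  have hs := @has_deriv_comp _ sin cos _ _ _ _ (is_derive_sin _) (phiw t It).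
  have := has_derivD (has_derivM (smooth_on_deriv sc It) hc)
                     (has_derivM (smooth_on_deriv ss It) hs).
  congr has_deriv; rewrite -/dc -/ds.
  have ort' := ort t It; have cs1' := cs1 t It.
  have dcE : dc t = - (s t * w t).
    rewrite -[LHS]mulr1 -[X in _ * X = _]cs1' /w.
    transitivity (c t * (c t * dc t) + dc t * s t ^+ 2); first by ring.
    have -> : c t * dc t = - (s t * ds t) by lra.
    by ring.
  have dsE : ds t = c t * w t.
    rewrite -[LHS]mulr1 -[X in _ * X = _]cs1' /w.
    transitivity (s t * (s t * ds t) + ds t * c t ^+ 2); first by ring.
    have -> : s t * ds t = - (c t * dc t) by lra.
    by ring.
  by rewrite dcE dsE /=; ring.
move=> t It.
have := const_of_deriv0 I_itv key It It0.
have -> : phi t0 = p0 by rewrite /phi addrCA subrr addr0.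
rewrite cp0 sp0 -!expr2 cs1// => h1.
have h2 := cos2Dsin2 (phi t); have h3 := cs1 t It.
(* Two unit vectors with scalar product 1 are equal. *)
have : (c t - cos (phi t)) ^+ 2 + (s t - sin (phi t)) ^+ 2 == 0.
  by apply/eqP; rewrite !expr2 in h2 h3 *; lra.
rewrite paddr_eq0 ?sqr_ge0// !sqrf_eq0 !subr_eq0 => /andP[/eqP -> /eqP ->].
by [].
Qed.

End Lift.

(** * Vector algebra in dimension three *)

Section Vectors.
Context {R : realType}.
Implicit Types x y z : 'rV[R]_3.

Lemma dot_is_bilinear : bilinear_for
  (GRing.Scale.Law.clone _ _ *:%R _) (GRing.Scale.Law.clone _ _ *:%R _) (@dot R).
Proof.
split=> [u'|u] a x y /=; rewrite /dot scaler_sumr -big_split/=;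
  apply: eq_bigr => i _; rewrite !mxE /GRing.scale/=; ring.
Qed.
HB.instance Definition _ := bilinear_isBilinear.Build R 'rV[R]_3 'rV[R]_3 R _ _
  (@dot R) dot_is_bilinear.

Lemma cross_is_bilinear : bilinear_for
  (GRing.Scale.Law.clone _ _ *:%R _) (GRing.Scale.Law.clone _ _ *:%R _) (@cross R).
Proof.
by split=> [u'|u] a x y /=; apply/rowP => k; rewrite !mxE; ring.
Qed.
HB.instance Definition _ := bilinear_isBilinear.Build R 'rV[R]_3 'rV[R]_3 'rV[R]_3 _ _
  (@cross R) cross_is_bilinear.

Lemma coord_fst_continuous n (i : 'I_n) :
  continuous (fun p : 'rV[R]_n * 'rV[R]_n => p.1 0 i).
Proof.
move=> p; apply: (@continuous_comp _ _ _ fst (fun x : 'rV[R]_n => x 0 i)).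
  exact: cvg_fst.
exact: coord_continuous.
Qed.

Lemma coord_snd_continuous n (i : 'I_n) :
  continuous (fun p : 'rV[R]_n * 'rV[R]_n => p.2 0 i).
Proof.
move=> p; apply: (@continuous_comp _ _ _ snd (fun x : 'rV[R]_n => x 0 i)).
  exact: cvg_snd.
exact: coord_continuous.
Qed.

Lemma dotE x y : dot x y = x 0 0 * y 0 0 + x 0 1 * y 0 1 + x 0 2 * y 0 2.
Proof.
rewrite /dot !big_ord_recr big_ord0 /= add0r.
by congr (_ * _ + _ * _ + _ * _); congr (_ 0 _); apply: val_inj.
Qed.

Lemma crossE x y :
  [/\ cross x y 0 0 = x 0 1 * y 0 2 - x 0 2 * y 0 1,
      cross x y 0 1 = x 0 2 * y 0 0 - x 0 0 * y 0 2 &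
      cross x y 0 2 = x 0 0 * y 0 1 - x 0 1 * y 0 0].
Proof.
by split; rewrite mxE; congr (_ * _ - _ * _); congr (_ 0 _); apply: val_inj.
Qed.

Lemma dot_continuous : continuous (fun p : 'rV[R]_3 * 'rV[R]_3 => dot p.1 p.2).
Proof.
move=> p; rewrite /continuous_at; under eq_cvg do rewrite dotE.
rewrite dotE; do 2?[apply: cvgD];
  by apply: cvgM; [exact: coord_fst_continuous|exact: coord_snd_continuous].
Qed.

Lemma cross_continuous : continuous (fun p : 'rV[R]_3 * 'rV[R]_3 => cross p.1 p.2).
Proof.
move=> p; apply/cvg_ballP => e e0.
pose near_at (j : 'I_3) q := ball (cross p.1 p.2 0 j) e (cross q.1 q.2 0 j).
suff : \forall q \near p, forall j, near_at j q.
  by apply: filterS => q pq; split=> // i j; rewrite ord1; exact: pq.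
apply: (@filter_forall _ 'I_3 near_at (nbhs p) _) => j.
have : cross q.1 q.2 0 j @[q --> p] --> cross p.1 p.2 0 j.
  under eq_cvg do rewrite mxE.
  by rewrite mxE; apply: cvgB; apply: cvgM;
    (exact: coord_fst_continuous || exact: coord_snd_continuous).
by move=> /cvg_ballP; apply.
Qed.

Lemma dotC x y : dot x y = dot y x.
Proof. by apply: eq_bigr => i _; rewrite mulrC. Qed.

Lemma dotDl x y z : dot (x + y) z = dot x z + dot y z.
Proof. exact: linearDl (@dot R) z x y. Qed.

Lemma dotZl (a : R) x y : dot (a *: x) y = a * dot x y.
Proof. exact: linearZl_LR (@dot R) y a x. Qed.

Lemma dotDr x y z : dot x (y + z) = dot x y + dot x z.
Proof. by rewrite dotC dotDl !(dotC _ x). Qed.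

Lemma dotZr (a : R) x y : dot x (a *: y) = a * dot x y.
Proof. by rewrite dotC dotZl dotC. Qed.

Lemma dotBr x y z : dot x (y - z) = dot x y - dot x z.
Proof. by rewrite dotDr -scaleN1r dotZr mulN1r. Qed.

Lemma dotBl x y z : dot (x - y) z = dot x z - dot y z.
Proof. by rewrite dotC dotBr !(dotC z). Qed.

Lemma dot_crossl x y : dot x (cross x y) = 0.
Proof. by have [c0 c1 c2] := crossE x y; rewrite dotE c0 c1 c2; ring. Qed.

Lemma dot_crossr x y : dot y (cross x y) = 0.
Proof. by have [c0 c1 c2] := crossE x y; rewrite dotE c0 c1 c2; ring. Qed.

(** Lagrange's identity. *)
Lemma dot_cross x y :
  dot (cross x y) (cross x y) = dot x x * dot y y - dot x y ^+ 2.
Proof. by have [c0 c1 c2] := crossE x y; rewrite !dotE c0 c1 c2; ring. Qed.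

Lemma dot_mulmx x y : dot x y = (x *m y^T) 0 0.
Proof. by rewrite mxE; apply: eq_bigr => i _; rewrite mxE. Qed.

(** The matrix [M] with rows [u], [v], [u x v] satisfies [M M^T = 1], hence also
    [M^T M = 1]: passing to coordinates in this frame preserves scalar products. *)
Lemma parseval (u v x y : 'rV[R]_3) : Delta (u, v) ->
  dot x y = dot x u * dot y u + dot x v * dot y v
            + dot x (cross u v) * dot y (cross u v).
Proof.
case; rewrite /S2/= => uu vv uv; set w := cross u v.
have ww : dot w w = 1 by rewrite dot_cross uu vv uv; ring.
pose e (i : 'I_3) := if i == 0 then u else if i == 1 then v else w.
pose M : 'M[R]_3 := \matrix_(i, j) e i 0 j.
have MM : M *m M^T = 1%:M.
  apply/matrixP => i j; rewrite mxE.
  transitivity (dot (e i) (e j)); first by apply: eq_bigr => k _; rewrite !mxE.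
  rewrite mxE.
  have uw := dot_crossl u v; have vw := dot_crossr u v.
  case: i => -[|[|[|//]]] i3; case: j => -[|[|[|//]]] j3;
    rewrite /e/= ?uu ?vv ?ww ?uv ?uw ?vw//;
    by rewrite dotC ?uv ?uw ?vw.
have xM z i : (z *m M^T) 0 i = dot z (e i).
  by rewrite mxE; apply: eq_bigr => k _; rewrite !mxE.
have xy : x *m y^T = (x *m M^T) *m (y *m M^T)^T.
  by rewrite trmx_mul trmxK mulmxA -(mulmxA x) (mulmx1C MM) mulmx1.
by rewrite dot_mulmx xy -dot_mulmx dotE !xM.
Qed.

End Vectors.

(** * Framed curves *)

Section VectorCalculus.
Context {R : realType} (I : set R).
Hypothesis I_itv : is_interval I.
Hypothesis I_nondeg : exists a b, [/\ I a, I b & a < b].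

Lemma smooth_on_dot (f g : R -> 'rV[R]_3) :
  smooth_on I f -> smooth_on I g -> smooth_on I (fun t => dot (f t) (g t)).
Proof.
exact: (smooth_on_bilinear I_itv I_nondeg (@dot_continuous R) (B := @dot R)).
Qed.

Lemma smooth_on_cross (f g : R -> 'rV[R]_3) :
  smooth_on I f -> smooth_on I g -> smooth_on I (fun t => cross (f t) (g t)).
Proof.
exact: (smooth_on_bilinear I_itv I_nondeg (@cross_continuous R) (B := @cross R)).
Qed.

(** Differentiate [v . v = 1]. *)
Lemma derive_in_unit_ortho (v : R -> 'rV[R]_3) t : smooth_on I v ->
  (forall s, I s -> S2 (v s)) -> I t -> dot (derive_in I v t) (v t) = 0.
Proof.
move=> sv v1 It; have vt := smooth_on_deriv sv It.
have h1 := has_deriv_bilinear (@dot_continuous R) (B := @dot R) vt vt.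
have h2 : has_deriv I (fun s => dot (v s) (v s)) t 0.
  apply: (has_deriv_eq _ It (has_deriv_cst I (1 : R) t)) => u.
  by rewrite inE => Iu; rewrite v1.
have := has_deriv_uniq I_itv I_nondeg It h1 h2; rewrite /= (dotC (v t)).
by move=> ?; lra.
Qed.

(** Rotations of the normal plane preserve orthonormality and orthogonality to
    [gamma']. As [v] and [w] are only known on [I], their smoothness is that of the
    two combinations of [nu1] and [nu2] that they equal there. *)
Lemma framed_curve_rotate (gamma nu1 nu2 v w : R -> 'rV[R]_3) :
  framed_curve I gamma nu1 nu2 -> rotated_frame I nu1 nu2 v w ->
  framed_curve I gamma v w.
Proof.
move=> [sg s1 s2 D g0] [th [sth vw]].
have sc := smooth_on_cos I_itv I_nondeg sth.
have ss := smooth_on_sin I_itv I_nondeg sth.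
split; first exact: sg.
- apply: (smooth_on_eq I_itv I_nondeg
      (f := fun t => cos (th t) *: nu1 t - sin (th t) *: nu2 t)).
    by move=> t; rewrite inE => /vw[-> _].
  exact: smooth_onB (smooth_onZ _ _ sc s1) (smooth_onZ _ _ ss s2).
- apply: (smooth_on_eq I_itv I_nondeg
      (f := fun t => sin (th t) *: nu1 t + cos (th t) *: nu2 t)).
    by move=> t; rewrite inE => /vw[_ ->].
  exact: smooth_onD (smooth_onZ _ _ ss s1) (smooth_onZ _ _ sc s2).
- move=> t It; have [-> ->] := vw t It; have [/= n11 n22 n12] := D t It.
  have cs := cos2Dsin2 (th t); rewrite !expr2 in cs.
  rewrite /S2/= in n11 n22.
  have n21 : dot (nu2 t) (nu1 t) = 0 by rewrite dotC.
  by split; rewrite /S2/= !(dotBl, dotBr, dotDl, dotDr, dotZl, dotZr);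
    rewrite n11 n22 n12 n21; lra.
- move=> t It; have [-> ->] := vw t It; have [g1 g2] := g0 t It.
  by rewrite !(dotBr, dotDr, dotZr) g1 g2; split; ring.
Qed.

End VectorCalculus.

Theorem proposition3p1 (R : realType) (I : set R)
    (I_itv : is_interval I) (I_nondeg : exists a b, [/\ I a, I b & a < b])
    (gamma nu1 nu2 v w : R -> 'rV[R]_3) (lambda : R) :
  framed_curve I gamma nu1 nu2 ->
  rotated_frame I nu1 nu2 v w ->
  lambda != 0 ->
  (exists n : R -> 'rV[R]_3,
      [/\ smooth_on I n, forall t, I t -> S2 (n t) &
          framed_curve I (fun t => gamma t + lambda *: v t) v n])
  <->
  (exists phi : R -> R,
      smooth_on I phi /\
      forall t, I t ->
        lambda * curv_l I v w t * cos (phi t)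
        - (curv_alpha I gamma v w t + lambda * curv_m I v w t) * sin (phi t)
        = 0).
Proof.
move=> fc rot _; have [sg sv sw D g0] := framed_curve_rotate I_itv I_nondeg fc rot.
pose P t := gamma t + lambda *: v t.
pose mu := unit_tangent v w.
have smu : smooth_on I mu by exact: smooth_on_cross sv sw.
have sP : smooth_on I P.
  apply: (smooth_onD I_itv I_nondeg sg); apply: (smooth_onZ I_itv I_nondeg _ sv).
  exact: smooth_on_cst.
have v1 t : I t -> S2 (v t) by move=> /D[].
have PE t : I t -> derive_in I P t = derive_in I gamma t + lambda *: derive_in I v t.
  move=> It; apply: (derive_inE I_itv I_nondeg It).
  have gt := smooth_on_deriv sg It; have vt := smooth_on_deriv sv It.
  have := has_derivD gt (has_deriv_bilinear (@scale_continuous _ _)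
    (has_deriv_cst I (lambda : R^o) t) vt
    (B := @GRing.scale R 'rV[R]_3 : R^o -> _ -> _)).
  by rewrite /= scale0r add0r.
(* The coordinates of P' in the frame v, w, mu. *)
have Pv t : I t -> dot (derive_in I P t) (v t) = 0.
  move=> It; rewrite PE// dotDl dotZl.
  have [-> _] := g0 t It; rewrite derive_in_unit_ortho//; ring.
have Pw t : I t -> dot (derive_in I P t) (w t) = lambda * curv_l I v w t.
  move=> It; rewrite PE// dotDl dotZl.
  by have [_ ->] := g0 t It; rewrite add0r.
have Pmu t : I t -> dot (derive_in I P t) (mu t) =
    curv_alpha I gamma v w t + lambda * curv_m I v w t.
  by move=> It; rewrite PE// dotDl dotZl.
split.
- move=> [n [sn n1 [_ _ _ Dn Pn]]].
  pose a t := dot (n t) (w t); pose b t := dot (n t) (mu t).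
  have vn t : I t -> dot (n t) (v t) = 0.
    by move=> /Dn[_ _ /=]; rewrite dotC.
  have sa : smooth_on I a by exact: smooth_on_dot sn sw.
  have sb : smooth_on I (fun t => - b t).
    apply: (smooth_on_eq I_itv I_nondeg (f := fun t => 0 - b t)).
      by move=> t _; rewrite sub0r.
    apply: (smooth_onB I_itv I_nondeg); first exact: smooth_on_cst.
    exact: smooth_on_dot sn smu.
  have [phi [sphi phiE]] : exists phi, smooth_on I phi /\
      forall t, I t -> cos (phi t) = a t /\ sin (phi t) = - b t.
    apply: (angle_lift I_itv I_nondeg sa sb) => t It; have := n1 t It.
    rewrite /S2/= (parseval _ _ (D t It)) vn// -/(a t) -/(b t).
    by rewrite !expr2 => nn; lra.
  (* In the orthonormal frame, P' . n = 0 is the required equation. *)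
  exists phi; split; first exact: sphi.
  move=> t It; have [-> ->] := phiE t It.
  have [_] := Pn t It.
  rewrite (parseval _ _ (D t It)) -/(P t) Pv// Pw// -/(mu t) Pmu// => <-.
  rewrite -/(a t) -/(b t); ring.
- move=> [phi [sphi phiE]].
  have sc := smooth_on_cos I_itv I_nondeg sphi.
  have ss := smooth_on_sin I_itv I_nondeg sphi.
  pose n t := cos (phi t) *: w t - sin (phi t) *: mu t.
  have sn : smooth_on I n.
    exact: smooth_onB (smooth_onZ _ _ sc sw) (smooth_onZ _ _ ss smu).
  have n1 t : I t -> S2 (n t).
    move=> It; have [/= vv ww vw] := D t It.
    have mm : dot (mu t) (mu t) = 1 by rewrite dot_cross vv ww vw; ring.
    have wm : dot (w t) (mu t) = 0 := dot_crossr _ _.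
    have mw : dot (mu t) (w t) = 0 by rewrite dotC.
    have cs := cos2Dsin2 (phi t); rewrite !expr2 in cs.
    rewrite /S2/= in ww *.
    rewrite /n !(dotBl, dotBr, dotZl, dotZr) ww mm wm mw; lra.
  exists n; split; [exact: sn|exact: n1|].
  split; [exact: sP|exact: sv|exact: sn| |] => t It.
    split=> /=; [exact: v1|exact: n1|].
    have [/= _ _ vw] := D t It.
    by rewrite /n dotBr !dotZr vw (dot_crossl _ _ : dot (v t) (mu t) = 0); ring.
  split; first exact: Pv.
  rewrite -/(P t) /n dotBr !dotZr Pw// Pmu//.
  by rewrite -(phiE t It); ring.
Qed.
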